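(* Let $Y\neq\{0\}$ be a Banach space, and let $B_{Y^*}$ be the closed unit ball of its dual $Y^*$, regarded as a pointed metric space with the metric induced by the norm of $Y^*$ and distinguished point $0$. Then there is a linear isometric embedding $U:Y\to\mathrm{Lip}_0(B_{Y^*})$ such that $U(Y)\subset\mathrm{SNA}(B_{Y^*})$.
   Context: All vector spaces are real. A pointed metric space $(M,\rho)$ is a metric space with at least 2 points and a distinguished point $0\in M$. $\mathrm{Lip}_0(M)$ is the Banach space of all Lipschitz functions $f:M\to\mathbb{R}$ with $f(0)=0$, normed by the Lipschitz constant $\|f\|=\sup\{|f(x)-f(y)|/\rho(x,y): x,y\in M,\ x\neq y\}$. A function $f\in\mathrm{Lip}_0(M)$ attains its norm strongly if there are $x\neq y$ in $M$ with $\|f\|=|f(x)-f(y)|/\rho(x,y)$; $\mathrm{SNA}(M)\subset\mathrm{Lip}_0(M)$ is the set of all such $f$. *)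

(* Defs.v *)
From HB Require Import structures.
From mathcomp Require Import all_boot all_order all_algebra.
From mathcomp Require Import all_classical all_reals all_analysis.

Set Implicit Arguments.
Unset Strict Implicit.
Unset Printing Implicit Defensive.

Import Order.TTheory GRing.Theory Num.Theory.
Import numFieldNormedType.Exports.

Local Open Scope classical_set_scope.
Local Open Scope ring_scope.

(******************************************************************************)
(*  pointedMetric R == metric spaces with at least two points and a           *)
(*                     distinguished point pm_base                            *)
(*           Lip0 M == normed module of the Lipschitz functions M -> R that   *)
(*                     vanish at pm_base; the norm is the Lipschitz constant  *)
(*            SNA M == the f : Lip0 M that attain their norm strongly         *)
(*           dual Y == normed module of the continuous linear functionals on  *)
(*                     Y, with the operator norm                              *)
(*       unitBall V == closed unit ball of V, with the metric induced by the  *)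
(*                     norm of V                                              *)
(*   unitBall_pm V0 == unitBall V pointed at 0, where V0 proves V != {0}      *)
(*      dualBall Y0 == the pointed metric space unitBall (dual Y), where Y0   *)
(*                     proves Y != {0}                                        *)
(******************************************************************************)

Record pointedMetric (R : realType) := PointedMetric {
  pm_sort :> metricType R ;
  pm_base : pm_sort ;
  pm_two_points : exists x y : pm_sort, x != y
}.

Section Lip0.
Context {R : realType} (M : pointedMetric R).

Definition lip0_set : set (M -> R) := [set f |
  (exists k : R, forall x y, `|f x - f y| <= k * mdist x y) /\
  f (pm_base M) = 0].

Definition lip0_pred : {pred M -> R} := mem lip0_set.

Lemma lip0_predP f : reflect (lip0_set f) (f \in lip0_pred).
Proof. exact: asboolP. Qed.

Record Lip0 : Type := MkLip0 {
  lip0_fun :> M -> R ;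
  _ : lip0_fun \in lip0_pred
}.

HB.instance Definition _ := [isSub for lip0_fun].
HB.instance Definition _ := gen_eqMixin Lip0.
HB.instance Definition _ := gen_choiceMixin Lip0.

Lemma lip0_submod_closed : submod_closed lip0_pred.
Proof.
split.
  apply/lip0_predP; split => //; exists 0 => x y.
  by rewrite mul0r /GRing.zero/= subrr normr0.
move=> a f g /lip0_predP[[k fk] f0] /lip0_predP[[l gl] g0].
apply/lip0_predP; split; last first.
  by rewrite !fctE f0 g0 scaler0 addr0.
exists (`|a| * k + l) => x y; rewrite !fctE.
have -> : a *: f x + g x - (a *: f y + g y) = a * (f x - f y) + (g x - g y).
  by rewrite mulrBr opprD addrACA.
rewrite (le_trans (ler_normD _ _))// mulrDl lerD//.
by rewrite normrM -mulrA ler_wpM2l.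
Qed.

HB.instance Definition _ := GRing.isSubmodClosed.Build _ _ lip0_pred
  lip0_submod_closed.
HB.instance Definition _ := [SubChoice_isSubLmodule of Lip0 by <:].

Definition slopes (f : M -> R) : set R :=
  [set `|f p.1 - f p.2| / mdist p.1 p.2 | p in [set p : M * M | p.1 != p.2]].

Definition lip0_norm (f : Lip0) : R := sup (slopes f).

Lemma slopes_neq0 (f : M -> R) : slopes f !=set0.
Proof.
have [x [y xy]] := pm_two_points M.
by exists (`|f x - f y| / mdist x y), (x, y).
Qed.

Lemma has_ubound_slopes (f : Lip0) : has_ubound (slopes f).
Proof.
case: f => f /= /lip0_predP[[k fk] _]; exists k => _ [[x y] /= xy <-].
by rewrite ler_pdivrMr ?mdist_gt0.
Qed.

Lemma lip0_normP (f : Lip0) x y : `|f x - f y| <= lip0_norm f * mdist x y.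
Proof.
have [->|xy] := eqVneq x y; first by rewrite subrr normr0 mdistxx mulr0.
rewrite -ler_pdivrMr ?mdist_gt0//.
by apply: ub_le_sup; [exact: has_ubound_slopes|exists (x, y)].
Qed.

Lemma lip0_norm_le (f : Lip0) k :
  (forall x y, `|f x - f y| <= k * mdist x y) -> lip0_norm f <= k.
Proof.
move=> fk; apply: ge_sup; first exact: slopes_neq0.
by move=> _ [[x y] /= xy <-]; rewrite ler_pdivrMr ?mdist_gt0.
Qed.

Lemma lip0_norm_ge0 (f : Lip0) : 0 <= lip0_norm f.
Proof.
have [x [y xy]] := pm_two_points M.
have := le_trans (normr_ge0 _) (lip0_normP f x y).
by rewrite pmulr_lge0// mdist_gt0.
Qed.

Lemma lip0_base (f : Lip0) : f (pm_base M) = 0.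
Proof. by case: f => f /= /lip0_predP[]. Qed.

Lemma lip0_ler_normD (f g : Lip0) :
  lip0_norm (f + g) <= lip0_norm f + lip0_norm g.
Proof.
apply: lip0_norm_le => x y /=.
rewrite [X in `|X|](_ : _ = (f x - f y) + (g x - g y)).
  by rewrite (le_trans (ler_normD _ _))// mulrDl lerD// lip0_normP.
by rewrite addrACA -opprD.
Qed.

Lemma lip0_normrZ (a : R) (f : Lip0) :
  lip0_norm (a *: f) = `|a| * lip0_norm f.
Proof.
have le b (g : Lip0) : lip0_norm (b *: g) <= `|b| * lip0_norm g.
  apply: lip0_norm_le => x y /=.
  rewrite [X in `|X|](_ : _ = b * (g x - g y)).
    by rewrite normrM -mulrA ler_wpM2l// lip0_normP.
  by rewrite mulrBr.
apply/eqP; rewrite eq_le le/=; have [->|a0] := eqVneq a 0.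
  by rewrite normr0 mul0r lip0_norm_ge0.
rewrite -ler_pdivlMl ?normr_gt0// -normfV.
by rewrite -[leLHS](_ : lip0_norm (a^-1 *: (a *: f)) = _) ?le// scalerK.
Qed.

Lemma lip0_normr0_eq0 (f : Lip0) : lip0_norm f = 0 -> f = 0.
Proof.
move=> f0; apply/val_inj/funext => x /=.
have := lip0_normP f x (pm_base M).
by rewrite f0 mul0r normr_le0 lip0_base subr0 => /eqP ->.
Qed.

HB.instance Definition _ := @Lmodule_isNormed.Build R Lip0
  lip0_norm lip0_ler_normD lip0_normrZ lip0_normr0_eq0.

Definition SNA : set Lip0 := [set f : Lip0 |
  exists x y : M, x != y /\ `|f| = `|f x - f y| / mdist x y].

End Lip0.
Arguments SNA {R} M _.

Section dual.
Context {R : realType} (Y : normedModType R).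

Definition dual_set : set (Y -> R) := [set f | linear f /\ continuous f].

Definition dual_pred : {pred Y -> R} := mem dual_set.

Lemma dual_predP f : reflect (dual_set f) (f \in dual_pred).
Proof. exact: asboolP. Qed.

Record dual : Type := MkDual {
  dual_fun :> Y -> R ;
  _ : dual_fun \in dual_pred
}.

HB.instance Definition _ := [isSub for dual_fun].
HB.instance Definition _ := gen_eqMixin dual.
HB.instance Definition _ := gen_choiceMixin dual.

Lemma dual_submod_closed : submod_closed dual_pred.
Proof.
split.
  apply/dual_predP; split; last by move=> x; exact: cvg_cst.
  by move=> a x y; rewrite /GRing.zero/= scaler0 addr0.
move=> a f g /dual_predP[lf cf] /dual_predP[lg cg]; apply/dual_predP; split.
  move=> b x y; rewrite !fctE lf lg !scalerDr addrACA; congr (_ + _ + _).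
  by rewrite !scalerA mulrC.
by move=> x; apply: cvgD; [apply: cvgZr; exact: cf|exact: cg].
Qed.

HB.instance Definition _ := GRing.isSubmodClosed.Build _ _ dual_pred
  dual_submod_closed.
HB.instance Definition _ := [SubChoice_isSubLmodule of dual by <:].

Definition dual_values (f : Y -> R) : set R :=
  [set `|f y| | y in [set y | `|y| <= 1]].

Definition dual_norm (f : dual) : R := sup (dual_values f).

Lemma dual_linear (f : dual) : linear f.
Proof. by case: f => f /= /dual_predP[]. Qed.

Lemma dual_continuous (f : dual) : continuous f.
Proof. by case: f => f /= /dual_predP[]. Qed.

HB.instance Definition _ (f : dual) :=
  @GRing.isLinear.Build R Y R _ (dual_fun f) (dual_linear f).

Lemma has_ubound_dual_values (f : dual) : has_ubound (dual_values f).
Proof.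
have /linear_bounded_continuous/linear_boundedP := @dual_continuous f.
move=> /pinfty_ex_gt0[r r0 fr]; exists r => _ [y /= y1 <-].
by rewrite (le_trans (fr y))// ler_piMr// ltW.
Qed.

Lemma dual_norm_ge0 (f : dual) : 0 <= dual_norm f.
Proof.
apply: ub_le_sup; first exact: has_ubound_dual_values.
by exists 0; rewrite /= ?normr0// linear0 normr0.
Qed.

Lemma dual_normP (f : dual) y : `|f y| <= dual_norm f * `|y|.
Proof.
have [->|y0] := eqVneq y 0; first by rewrite linear0 !normr0 mulr0.
rewrite -ler_pdivrMr ?normr_gt0//.
apply: ub_le_sup; first exact: has_ubound_dual_values.
exists (`|y|^-1 *: y) => /=.
  by rewrite normrZ normfV normr_id mulVf// normr_eq0.
by rewrite linearZ/= normrM normfV normr_id mulrC.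
Qed.

Lemma dual_norm_le (f : dual) k :
  0 <= k -> (forall y, `|f y| <= k * `|y|) -> dual_norm f <= k.
Proof.
move=> k0 fk; apply: ge_sup; first by exists `|f 0|, 0; rewrite /= ?normr0.
by move=> _ [y /= y1 <-]; rewrite (le_trans (fk y))// ler_piMr.
Qed.

Lemma dual_ler_normD (f g : dual) :
  dual_norm (f + g) <= dual_norm f + dual_norm g.
Proof.
apply: dual_norm_le => [|y /=]; first by rewrite addr_ge0// dual_norm_ge0.
by rewrite (le_trans (ler_normD _ _))// mulrDl lerD// dual_normP.
Qed.

Lemma dual_normrZ (a : R) (f : dual) :
  dual_norm (a *: f) = `|a| * dual_norm f.
Proof.
have le b (g : dual) : dual_norm (b *: g) <= `|b| * dual_norm g.
  apply: dual_norm_le => [|y /=]; first by rewrite mulr_ge0// dual_norm_ge0.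
  by rewrite normrM -mulrA ler_wpM2l// dual_normP.
apply/eqP; rewrite eq_le le/=; have [->|a0] := eqVneq a 0.
  by rewrite normr0 mul0r dual_norm_ge0.
rewrite -ler_pdivlMl ?normr_gt0// -normfV.
by rewrite -[leLHS](_ : dual_norm (a^-1 *: (a *: f)) = _) ?le// scalerK.
Qed.

Lemma dual_normr0_eq0 (f : dual) : dual_norm f = 0 -> f = 0.
Proof.
move=> f0; apply/val_inj/funext => y /=.
by have := dual_normP f y; rewrite f0 mul0r normr_le0 => /eqP ->.
Qed.

HB.instance Definition _ := @Lmodule_isNormed.Build R dual
  dual_norm dual_ler_normD dual_normrZ dual_normr0_eq0.

End dual.

Section unitBall.
Context {R : realType} (V : normedModType R).

Record unitBall : Type := MkUnitBall {
  unitBall_val :> V ;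
  _ : `|unitBall_val| <= 1
}.

HB.instance Definition _ := [isSub for unitBall_val].
HB.instance Definition _ := gen_eqMixin unitBall.
HB.instance Definition _ := gen_choiceMixin unitBall.

Definition unitBall_dist (x y : unitBall) : R := `|(x : V) - (y : V)|.

Lemma unitBall_distxx x : unitBall_dist x x = 0.
Proof. by rewrite /unitBall_dist subrr normr0. Qed.

Lemma unitBall_dist_positivity x y : unitBall_dist x y = 0 -> x = y.
Proof. by move/normr0_eq0/subr0_eq/val_inj. Qed.

Lemma unitBall_dist_sym x y : unitBall_dist x y = unitBall_dist y x.
Proof. exact: distrC. Qed.

Lemma unitBall_dist_triangle y x z :
  unitBall_dist x z <= unitBall_dist x y + unitBall_dist y z.
Proof. exact: ler_distD. Qed.

HB.instance Definition _ := @isMetric.Build R unitBall unitBall_dist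
  unitBall_distxx unitBall_dist_positivity unitBall_dist_sym
  unitBall_dist_triangle.

Lemma norm0_le1 : `|0 : V| <= 1.
Proof. by rewrite normr0. Qed.

Definition unitBall0 : unitBall := MkUnitBall norm0_le1.

Lemma unitBall_two_points :
  (exists v : V, v != 0) -> exists x y : unitBall, x != y.
Proof.
move=> [v v0]; have v1 : `|(`|v|^-1 *: v)| <= 1.
  by rewrite normrZ normfV normr_id mulVf// normr_eq0.
exists (MkUnitBall v1), unitBall0; apply/eqP => /(congr1 unitBall_val)/= /eqP.
by rewrite scaler_eq0 invr_eq0 normr_eq0 (negbTE v0).
Qed.

Definition unitBall_pm (V0 : exists v : V, v != 0) : pointedMetric R :=
  PointedMetric unitBall0 (unitBall_two_points V0).

End unitBall.

(* Hahn-Banach: t *: y |-> t * `|y| extends to a functional dominated by the  *)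
(* norm. Partial functionals are represented by their graphs.                 *)
Section dual_neq0.
Context {R : realType} (Y : normedModType R).

Let dominated (G : set (Y * R)) := forall p, G p -> p.2 <= `|p.1|.

Let stable (G : set (Y * R)) :=
  forall a p q, G p -> G q -> G (a *: p.1 + q.1, a * p.2 + q.2).

Let extend (G : set (Y * R)) (x : Y) (c : R) : set (Y * R) :=
  [set p | exists q t, G q /\ p = (q.1 + t *: x, q.2 + t * c)].

Let extend_stable G x c : stable G -> stable (extend G x c).
Proof.
move=> sG a _ _ [p [s [Gp ->]]] [q [t [Gq ->]]] /=.
exists (a *: p.1 + q.1, a * p.2 + q.2), (a * s + t); split; first exact: sG.
by rewrite /= scalerDr scalerDl scalerA mulrDr mulrDl mulrA; congr pair;
  rewrite addrACA.
Qed.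

Let extend_dominated G x : stable G -> dominated G -> G !=set0 ->
  exists c, dominated (extend G x c).
Proof.
move=> sG dG [p0 Gp0].
have key p q : G p -> G q -> p.2 - `|p.1 - x| <= `|q.1 + x| - q.2.
  move=> Gp Gq; rewrite lerBlDr addrAC lerBrDr.
  have /dG/= := sG 1 _ _ Gp Gq; rewrite scale1r mul1r => /le_trans; apply.
  rewrite [leRHS]addrC.
  have -> : p.1 + q.1 = (p.1 - x) + (q.1 + x) by rewrite addrACA addNr addr0.
  exact: ler_normD.
pose A := [set p.2 - `|p.1 - x| | p in G].
have A0 : A !=set0 by exists (p0.2 - `|p0.1 - x|), p0.
have Aub : has_ubound A.
  by exists (`|p0.1 + x| - p0.2) => _ [p Gp <-]; exact: key.
have lo p : G p -> p.2 - `|p.1 - x| <= sup A.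
  by move=> Gp; apply: ub_le_sup => //; exists p.
have hi q : G q -> sup A <= `|q.1 + x| - q.2.
  by move=> Gq; apply: ge_sup => // _ [p Gp <-]; exact: key.
have G0 : G (0, 0).
  by have := sG (-1) _ _ Gp0 Gp0; rewrite scaleN1r mulN1r !addNr.
have scal a p : G p -> G (a *: p.1, a * p.2).
  by move=> Gp; have := sG a _ _ Gp G0; rewrite !addr0.
exists (sup A) => _ [q [t [Gq ->]]] /=.
have [t0|t0|->] := ltgtP t 0.
- have /lo/= := scal (- t)^-1 _ Gq.
  have tN : 0 < - t by rewrite oppr_gt0.
  have -> : (- t)^-1 *: q.1 - x = (- t)^-1 *: (q.1 + t *: x).
    by rewrite scalerDr scalerA invrN mulNr mulVf ?lt_eqF// scaleN1r.
  rewrite normrZ gtr0_norm ?invr_gt0// -mulrBr ler_pdivrMl//.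
  by rewrite mulNr lerBlDr addrC -lerBlDr opprK.
- have /hi/= := scal t^-1 _ Gq.
  have -> : t^-1 *: q.1 + x = t^-1 *: (q.1 + t *: x).
    by rewrite scalerDr scalerA mulVf ?gt_eqF// scale1r.
  rewrite normrZ gtr0_norm ?invr_gt0// -mulrBr ler_pdivlMl//.
  by rewrite lerBrDr addrC.
- by rewrite scale0r mul0r !addr0; exact: dG.
Qed.

Lemma dual_norming (y : Y) : exists2 f : dual Y, `|f| <= 1 & f y = `|y|.
Proof.
pose P G := [/\ stable G, dominated G & G = set0 \/ G (y, `|y|)].
have [|G [[sG dG oG] Gmax]] := @Zorn_bigcup _ P.
  move=> F FP Ftot; split.
  - move=> a p q [G FG Gp] [H FH Hq].
    by have [GH|HG] := Ftot _ _ FG FH;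
      [exists H => //; have [+ _ _] := FP _ FH; apply => //; exact: GH|
       exists G => //; have [+ _ _] := FP _ FG; apply => //; exact: HG].
  - by move=> p [G /FP[_ dG _] /dG].
  - have [[G FG Gy]|nG] := pselect (exists2 G, F G & G (y, `|y|)).
      by right; exists G.
    left; rewrite -subset0 => p [G FG Gp]; apply: nG; exists G => //.
    by have [_ _ [G0|//]] := FP _ FG; rewrite G0 in Gp.
have Gy : G (y, `|y|).
  have [G0|//] := oG; exfalso.
  apply: (Gmax [set p | exists t, p = (t *: y, t * `|y|)]).
    rewrite G0; split => //; first by move=> /(_ (y, `|y|)); apply;
      exists 1; rewrite scale1r mul1r.
  split; last by right; exists 1; rewrite scale1r mul1r.
  - move=> a _ _ [s ->] [t ->] /=; exists (a * s + t).
    by rewrite scalerA mulrA -scalerDl -mulrDl.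
  - by move=> _ [t ->] /=; rewrite normrZ ler_wpM2r// ler_norm.
have G0 : G (0, 0).
  by have := sG (-1) _ _ Gy Gy; rewrite scaleN1r mulN1r !addNr.
have tot x : exists r, G (x, r).
  have [c dc] := extend_dominated x sG dG (ex_intro _ _ Gy).
  have sub : G `<=` extend G x c.
    by move=> [u r] Gp; exists (u, r), 0; rewrite scale0r mul0r !addr0.
  have ex : extend G x c (x, c).
    by exists (0, 0), 1; rewrite scale1r mul1r !add0r.
  apply: contrapT => nx; apply: (Gmax (extend G x c)).
    by split => // /(_ _ ex) Gx; apply: nx; exists c.
  by split; [exact: extend_stable|exact: dc|right; exact: sub].
have uniq x r s : G (x, r) -> G (x, s) -> r = s.
  have le r' s' : G (x, r') -> G (x, s') -> r' <= s'.
    move=> Gr Gs; have := dG _ (sG (-1) _ _ Gs Gr).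
    by rewrite /= scaleN1r mulN1r addNr normr0 addrC subr_le0.
  by move=> Gr Gs; apply/eqP; rewrite eq_le !le.
pose f x : R := projT1 (cid (tot x)).
have fG x : G (x, f x) by exact: projT2 (cid (tot x)).
have lf : linear f.
  by move=> a u v; apply: (uniq _ _ _ (fG _)); exact: (sG a _ _ (fG u) (fG v)).
have fle x : `|f x| <= `|x|.
  rewrite ler_norml (dG _ (fG x) : f x <= `|x|) andbT lerNl.
  by have := dG _ (sG (-1) _ _ (fG x) G0); rewrite /= scaleN1r mulN1r !addr0 normrN.
have cf : continuous f.
  pose g : {linear Y -> R} := HB.pack f (GRing.isLinear.Build R Y R _ f lf).
  apply: (@bounded_linear_continuous _ _ _ g); apply/linear_boundedP.
  exists 1; split=> // r r1 x.
  by rewrite (le_trans (fle x))// ler_peMl// ltW.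
have fd : f \in @dual_set R Y by rewrite inE.
exists (MkDual fd); last exact: uniq (fG y) Gy.
by apply: dual_norm_le => // x; rewrite mul1r; exact: fle.
Qed.

(* This is what makes the unit ball of dual Y have two points. *)
Lemma dual_neq0 : (exists y : Y, y != 0) -> exists f : dual Y, f != 0.
Proof.
move=> [y y0]; have [f _ fy] := dual_norming y; exists f.
by apply: contra_neq y0 => f0; apply/normr0_eq0; rewrite -fy f0.
Qed.

End dual_neq0.

Definition dualBall (R : realType) (Y : normedModType R)
    (Y0 : exists y : Y, y != 0) : pointedMetric R :=
  unitBall_pm (dual_neq0 Y0).

(* Main.v *)
Require Import Defs.
From HB Require Import structures.
From mathcomp Require Import all_boot all_order all_algebra.
From mathcomp Require Import all_classical all_reals all_analysis.

(** The embedding sends [y] to the evaluation functional [f |-> f y] on the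
dual ball.  Since [|f y - g y| <= |f - g| |y|], this function is Lipschitz with
constant at most [|y|].  Hahn-Banach provides a functional [f] of norm exactly
1 with [f y = |y|] ([norming_unit_functional]), and the slope of the evaluation
between [f] and the base point 0 is then exactly [|y|].  So the Lipschitz
constant equals [|y|] and is attained at the pair [(f, 0)]: one pair of points
gives both the isometry and the strong norm attainment. *)

Set Implicit Arguments.
Unset Strict Implicit.
Unset Printing Implicit Defensive.

Import Order.TTheory GRing.Theory Num.Theory.
Import numFieldNormedType.Exports.

Local Open Scope classical_set_scope.
Local Open Scope ring_scope.

(** The norm has to be 1 and not merely at most 1 for the slope towards 0 to be
[f y].  It is 1 automatically when [y != 0], because [|y| = f y <= |f| |y|]; a
functional norming any nonzero vector serves for [y = 0], which is why the
space has to be nonzero. *)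
Lemma norming_unit_functional (R : realType) (Y : normedModType R)
    (Y_neq0 : exists y : Y, y != 0) (y : Y) :
  exists2 f : dual Y, `|f| = 1 & f y = `|y|.
Proof.
have unit_norming z : z != 0 -> exists2 f : dual Y, `|f| = 1 & f z = `|z|.
  move=> z0; have [f f1 fz] := dual_norming z; exists f => //.
  apply/eqP; rewrite eq_le f1/=.
  have := dual_normP f z.
  by rewrite fz normr_id ler_pMl// normr_gt0.
have [->|] := eqVneq y 0; last exact: unit_norming.
have [z /unit_norming[f f1 _]] := Y_neq0; exists f => //.
by rewrite linear0 normr0.
Qed.

Lemma lip0_norm_attained (R : realType) (M : pointedMetric R) (f : Lip0 M)
    (k : R) (x y : M) : x != y ->
  (forall u v, `|f u - f v| <= k * mdist u v) ->
  `|f x - f y| = k * mdist x y -> `|f| = k.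
Proof.
move=> xy fk fxy; apply/eqP; rewrite eq_le; apply/andP; split.
  exact: lip0_norm_le.
by have := lip0_normP f x y; rewrite fxy ler_pM2r ?mdist_gt0.
Qed.

Section evaluation.
Context {R : realType} (Y : normedModType R).
Variable Y_neq0 : exists y : Y, y != 0.

Let B := dualBall Y_neq0.

Definition evaluation (y : Y) (f : B) : R := unitBall_val f y.

Lemma evaluation_lipschitz y f g :
  `|evaluation y f - evaluation y g| <= `|y| * mdist f g.
Proof. by rewrite mulrC; exact: dual_normP (unitBall_val f - unitBall_val g) y. Qed.

Lemma evaluation_lip0 y : evaluation y \in @lip0_pred R B.
Proof.
apply/lip0_predP; split => //; exists `|y|; exact: evaluation_lipschitz.
Qed.

Definition evaluation_embedding (y : Y) : Lip0 B := MkLip0 (evaluation_lip0 y).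

Lemma evaluation_embedding_linear : linear evaluation_embedding.
Proof.
move=> a y z; apply/val_inj/funext => f /=.
by rewrite /evaluation linearP.
Qed.

HB.instance Definition _ := GRing.isLinear.Build R Y (Lip0 B) _
  evaluation_embedding evaluation_embedding_linear.

Lemma evaluation_slope_attained (y : Y) :
  exists f g : B, [/\ f != g, mdist f g = 1 &
    `|evaluation y f - evaluation y g| = `|y| * mdist f g].
Proof.
have [f f1 fy] := norming_unit_functional Y_neq0 y.
have fle1 : `|f| <= 1 by rewrite f1.
pose F : B := MkUnitBall fle1; pose O : B := pm_base B.
have FO : mdist F O = 1.
  by rewrite -f1 -[in RHS](subr0 f).
exists F, O; split => //.
  by rewrite -mdist_gt0 FO.
by rewrite FO mulr1 /evaluation /= fy subr0 normr_id.
Qed.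

Lemma evaluation_embedding_isometry (y : Y) : `|evaluation_embedding y| = `|y|.
Proof.
have [f [g [fg _ slope]]] := evaluation_slope_attained y.
exact: (@lip0_norm_attained _ B (evaluation_embedding y) _ f g fg
  (evaluation_lipschitz y) slope).
Qed.

Lemma evaluation_embedding_SNA (y : Y) : SNA B (evaluation_embedding y).
Proof.
have [f [g [fg fg1 slope]]] := evaluation_slope_attained y.
exists f, g; split => //.
by rewrite evaluation_embedding_isometry slope fg1 mulr1 divr1.
Qed.

End evaluation.

Theorem proposition3p1 (R : realType) (Y : completeNormedModType R)
    (Y_neq0 : exists y : Y, y != 0) :
  exists U : {linear Y -> Lip0 (dualBall Y_neq0)},
    (forall y : Y, `|U y| = `|y|) /\ range U `<=` SNA (dualBall Y_neq0).
Proof.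
exists (evaluation_embedding Y_neq0); split.
  exact: evaluation_embedding_isometry.
by move=> _ [y _ <-]; exact: evaluation_embedding_SNA.
Qed.
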